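(* Let $(\mathcal{A}',\phi')$ be a scalar probability space, let $x_1',x_2'\in\mathcal{A}'$ be $R$-diagonal with $\{x_1',(x_1')^\star\}$ and $\{x_2',(x_2')^\star\}$ free, and let $t_1,\dots,t_N>0$ with $t_1+\cdots+t_N=1$. For $i\in\{1,2\}$ let $x_i,e_1,\dots,e_N\in(\mathcal{A}_i,\phi_i)$ be an upper triangular realization of $x_i'$ with respect to orthogonal projections $e_1,\dots,e_N$ of traces $t_1,\dots,t_N$, as described in the context. Let $\mathcal{D}$ be the unital algebra generated by $e_1,\dots,e_N$ (identified inside $\mathcal{A}_1$ and $\mathcal{A}_2$), let $(\mathcal{D}\subseteq\mathcal{A},E)$ be the free product of $(\mathcal{D}\subseteq\mathcal{A}_1,E_1)$ and $(\mathcal{D}\subseteq\mathcal{A}_2,E_2)$ with amalgamation over $\mathcal{D}$, and let $\phi=\phi_0\circ E$, where $\phi_0:\mathcal{D}\to\mathbb{C}$ is the linear functional with $\phi_0(e_k)=t_k$. Then $x_1x_2\in(\mathcal{A},\phi)$ and $x_1'x_2'\in(\mathcal{A}',\phi')$ are identically distributed.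
   Context: A scalar probability space $(\mathcal{A},\phi)$ is a unital $\star$-algebra with a normal, tracial, faithful state. A $\mathcal{D}$-valued probability space $(\mathcal{D}\subseteq\mathcal{A},E)$ is a unital $\star$-algebra with a unital $\star$-subalgebra $\mathcal{D}$ and a conditional expectation $E:\mathcal{A}\to\mathcal{D}$ (linear, $E(I)=I$, $E(d_1xd_2)=d_1E(x)d_2$). Identically distributed means that all $\star$-moments agree. Sets $X_s$ are free with amalgamation over $\mathcal{D}$ if, with $\mathcal{A}_s$ the algebra generated by $X_s\cup\mathcal{D}$, $E(x_1\cdots x_n)=0$ whenever $x_j\in\mathcal{A}_{s_j}$, $E(x_j)=0$, consecutive $s_j$ distinct; ''free'' is the case $\mathcal{D}=\mathbb{C}$ with $E$ the state. $\mathcal{D}$-valued cumulants $\kappa$ are the $\mathcal{D}$-bimodule maps $\kappa:\mathcal{A}^{\otimes_{\mathcal D}n}\to\mathcal{D}$ ($n\ge1$) determined by $E(a_1\cdots a_n)=\sum_{\pi\in NC(\{1,\dots,n\})}\kappa_\pi(a_1\otimes\cdots\otimes a_n)$, where $\kappa_\pi=\kappa$ if $\pi$ has one block, and otherwise one chooses an interval block $\{p+1,\dots,p+q\}$ of $\pi$, removes it, and multiplies $\kappa(a_{p+1}\otimes\cdots\otimes a_{p+q})$ into the right of $a_p$ (equivalently the left of $a_{p+q+1}$), recursively. $a$ is $R$-diagonal with amalgamation over $\mathcal{D}$ if $\kappa(d_1a^{s_1}\otimes\cdots\otimes d_na^{s_n})=0$ for all $d_i\in\mathcal{D}$ and all $s_i\in\{1,\star\}$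 with $(s_1,\dots,s_n)$ not of the form $(1,\star,\dots,1,\star)$ or $(\star,1,\dots,\star,1)$; $R$-diagonal means the case $\mathcal{D}=\mathbb{C}$ (with the state as $E$). Upper triangular realization. $(\mathcal{A}_i,\phi_i)$ is a scalar probability space with orthogonal projections $e_1,\dots,e_N$, $e_1+\cdots+e_N=I$, $\phi_i(e_k)=t_k$; it is equipped with the $\mathcal{D}$-valued structure $E_i(z)=\sum_k\frac{\phi_i(ze_k)}{\phi_i(e_k)}e_k$, where $\mathcal{D}$ is the unital algebra generated by $e_1,\dots,e_N$. The element $x_i\in\mathcal{A}_i$ has the same distribution as $x_i'$, is upper triangular with respect to $e_1,\dots,e_N$ (i.e. $e_kx_ie_l=0$ for $k>l$), is $R$-diagonal with amalgamation over $\mathcal{D}$ with respect to $E_i$, and $x_ix_i^\star$ is free from $\mathcal{D}$ with respect to $\phi_i$. *)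

(* Defs.v *)
From HB Require Import structures.
From mathcomp Require Import all_boot all_order all_algebra.
From mathcomp Require Import boolp classical_sets reals.
From mathcomp Require Import complex.

Set Implicit Arguments.
Unset Strict Implicit.
Unset Printing Implicit Defensive.

Import Order.TTheory GRing.Theory Num.Theory.

Local Open Scope ring_scope.

HB.mixin Record isStarAlgebra (C : numClosedFieldType) A
    of GRing.Algebra C A := {
  star : A -> A ;
  starK : involutive star ;
  starD : {morph star : x y / x + y} ;
  starZ : forall (c : C) (x : A), star (c *: x) = Num.conj c *: star x ;
  starM : forall x y : A, star (x * y) = star y * star x
}.

#[short(type="starAlgType")]
HB.structure Definition StarAlgebra (C : numClosedFieldType) :=
  { A of isStarAlgebra C A & GRing.Algebra C A }.

Section NonCrossingPartitions.
Variable n : nat.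

Definition noncrossing (P : {set {set 'I_n}}) : bool :=
  [forall V in P, forall W in P, (V != W) ==>
    [forall i in V, forall j in W, forall k in V, forall l in W,
      ~~ [&& (i < j)%N, (j < k)%N & (k < l)%N]]].

Definition NC : {set {set {set 'I_n}}} :=
  [set P : {set {set 'I_n}} | finset.partition P [set: 'I_n] && noncrossing P].

End NonCrossingPartitions.

(* Evaluation of kappa_pi on a word. A letter carries its original position in *)
(* {0, .., n-1}, so that pi needs no renumbering when a block is removed. A    *)
(* block is an interval of the current word when its increasing enumeration is *)
(* a contiguous factor of the remaining positions.                             *)
Section PartitionCumulant.
Variables (A : pzRingType) (kappa : seq A -> A) (n : nat).
Implicit Types (P : {set {set 'I_n}}) (w l r : seq ('I_n * A)) (v : A).

(* The word l ++ r with v inserted in between: to the right of the last letter *)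
(* of l if there is one, otherwise to the left of the first letter of r.       *)
Definition insert_value l v r :=
  if l is x :: l' then
    rcons (belast x l') ((last x l').1, (last x l').2 * v) ++ r
  else if r is y :: r' then (y.1, v * y.2) :: r'
  else [::].

Definition remove_interval (V : {set 'I_n}) w :=
  let p := infix_index (enum V) (unzip1 w) in
  insert_value (take p w)
               (kappa (unzip2 (take #|V| (drop p w))))
               (drop (p + #|V|) w).

(* m is the number of blocks of P minus one; the last default is not reached   *)
(* on noncrossing partitions, which always have an interval block.             *)
Fixpoint partition_cumulant_rec (m : nat) P w : A :=
  if m is m'.+1 then
    if [pick V in P | infix (enum V) (unzip1 w)] is Some V then
      partition_cumulant_rec m' (P :\ V) (remove_interval V w)
    else 0
  else kappa (unzip2 w).

Definition partition_cumulant P (a : 'I_n -> A) : A :=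
  partition_cumulant_rec #|P|.-1 P [seq (i, a i) | i <- enum 'I_n].

End PartitionCumulant.

Local Open Scope classical_set_scope.

Section StarAlgebraTheory.
Variables (C : numClosedFieldType) (A : starAlgType C).
Implicit Types (D X : set A) (E : A -> A) (phi : A -> C) (a x y : A).

Definition generated_algebra X : set A :=
  smallest (fun B : set A => GRing.subalg_closed (mem B)) X.

Definition scalars : set A := range (fun c : C => c%:A).

Definition star_nonneg x := exists s : seq A, x = \sum_(b <- s) star b * b.

Definition star_le x y := star_nonneg (y - x).

Definition selfadjoint x := star x = x.

Definition star_sup X u :=
  [/\ selfadjoint u, (forall x, X x -> star_le x u)
    & forall v, selfadjoint v -> (forall x, X x -> star_le x v) -> star_le u v].

(* phi preserves suprema of bounded increasing nets of selfadjoint elements;   *)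
(* nets are rendered as directed sets. On a von Neumann algebra this is the    *)
(* usual normality.                                                            *)
Definition normal_functional phi :=
  forall (X : set A) (u : A),
    X !=set0 -> X `<=` selfadjoint ->
    (forall x y, X x -> X y ->
       exists z, [/\ X z, star_le x z & star_le y z]) ->
    star_sup X u ->
    forall c : C, (forall x, X x -> phi x <= c) -> phi u <= c.

Record scalar_probability_space (phi : {scalar A}) : Prop := {
  state_unital : phi 1 = 1 ;
  state_positive : forall a, 0 <= phi (star a * a) ;
  state_normal : normal_functional phi ;
  state_tracial : forall a b : A, phi (a * b) = phi (b * a) ;
  state_faithful : forall a, phi (star a * a) = 0 -> a = 0
}.

(* A functional, seen as a map onto the scalar subalgebra. *)
Definition scalar_expectation phi : A -> A := fun a => (phi a)%:A.

Record valued_probability_space D (E : {linear A -> A}) : Prop := {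
  base_subalgebra : GRing.subalg_closed (mem D) ;
  base_star : forall d, D d -> D (star d) ;
  expectation_range : forall a, D (E a) ;
  expectation_unital : E 1 = 1 ;
  expectation_bimodule : forall d1 d2 a,
    D d1 -> D d2 -> E (d1 * a * d2) = d1 * E a * d2
}.

Definition free_over D E (I : Type) (X : I -> set A) :=
  forall (n : nat) (s : 'I_n.+1 -> I) (a : 'I_n.+1 -> A),
    (forall j, generated_algebra (X (s j) `|` D) (a j)) ->
    (forall j, E (a j) = 0) ->
    (forall j k : 'I_n.+1, k = j.+1 :> nat -> s j <> s k) ->
    E (\prod_j a j) = 0.

Definition free_pair_over D E (X Y : set A) :=
  free_over D E (fun b : bool => if b then X else Y).

Definition free_pair phi (X Y : set A) :=
  free_pair_over scalars (scalar_expectation phi) X Y.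

(* kappa s stands for kappa (s_1 (x) .. (x) s_n), n = size s; its value on the *)
(* empty word is irrelevant. The first five fields say that, for each n >= 1,  *)
(* kappa is a D-bimodule map from the n-fold tensor power over D into D.       *)
Record cumulants D E (kappa : seq A -> A) : Prop := {
  cumulant_range : forall s, s != [::] -> D (kappa s) ;
  cumulant_linear : forall (s t : seq A) (c : C) (x y : A),
    kappa (s ++ (c *: x + y) :: t)
      = c *: kappa (s ++ x :: t) + kappa (s ++ y :: t) ;
  cumulant_balanced : forall (s t : seq A) (x y d : A), D d ->
    kappa (s ++ x * d :: y :: t) = kappa (s ++ x :: d * y :: t) ;
  cumulant_left : forall (s : seq A) (x d : A), D d ->
    kappa (d * x :: s) = d * kappa (x :: s) ;
  cumulant_right : forall (s : seq A) (x d : A), D d ->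
    kappa (rcons s (x * d)) = kappa (rcons s x) * d ;
  moment_cumulant : forall (n : nat) (a : 'I_n.+1 -> A),
    E (\prod_i a i) = \sum_(P in NC n.+1) partition_cumulant kappa P a
}.

(* a^1 = a and a^* = star a, the exponent * being coded by true. *)
Definition star_power a (b : bool) : A := if b then star a else a.

Definition alternating_even (s : seq bool) :=
  exists k, s = flatten (nseq k [:: false; true])
         \/ s = flatten (nseq k [:: true; false]).

(* The cumulants exist and are unique on nonempty words when E is a conditional *)
(* expectation onto D, so "exists" could equivalently be "for all".             *)
Definition R_diagonal_over D E a :=
  exists kappa : seq A -> A, cumulants D E kappa /\
    forall w : seq (A * bool), w != [::] ->
      (forall p, p \in w -> D p.1) ->
      ~ alternating_even (unzip2 w) ->
      kappa [seq p.1 * star_power a p.2 | p <- w] = 0.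

Definition R_diagonal phi a :=
  R_diagonal_over scalars (scalar_expectation phi) a.

Definition diagonal_expectation phi (N : nat) (e : 'I_N -> A) : A -> A :=
  fun z => \sum_k (phi (z * e k) / phi (e k)) *: e k.

End StarAlgebraTheory.

Definition identically_distributed (C : numClosedFieldType)
    (A B : starAlgType C) (phi : A -> C) (psi : B -> C) (a : A) (b : B) :=
  forall s : seq bool,
    phi (\prod_(i <- s) star_power a i) = psi (\prod_(i <- s) star_power b i).

Record upper_triangular_realization (R : realType) (A B : starAlgType R[i])
    (phi : {scalar A}) (x : A) (N : nat) (e : 'I_N -> A) (t : 'I_N -> R)
    (psi : {scalar B}) (y : B) : Prop := {
  utr_space : scalar_probability_space phi ;
  utr_proj : forall k, star (e k) = e k /\ e k * e k = e k ;
  utr_orth : forall k l, k != l -> e k * e l = 0 ;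
  utr_sum : \sum_k e k = 1 ;
  utr_trace : forall k, phi (e k) = (t k)%:C%C ;
  utr_dist : identically_distributed phi psi x y ;
  utr_triangular : forall k l : 'I_N, (l < k)%N -> e k * x * e l = 0 ;
  utr_R_diagonal : R_diagonal_over (generated_algebra (range e))
                     (diagonal_expectation phi e) x ;
  utr_free : free_pair phi [set x * star x] (generated_algebra (range e))
}.

(* (D <= A, E) is the free product of (D1 <= A1, E1) and (D2 <= A2, E2) with   *)
(* amalgamation, where D1 and D2 are generated by e1 and e2, are identified    *)
(* along e1 k = e2 k, and j1, j2 are the inclusions of A1, A2 into A.          *)
Record amalgamated_free_product (C : numClosedFieldType)
    (A1 A2 A : starAlgType C) (N : nat)
    (e1 : 'I_N -> A1) (E1 : A1 -> A1) (e2 : 'I_N -> A2) (E2 : A2 -> A2)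
    (j1 : {lrmorphism A1 -> A}) (j2 : {lrmorphism A2 -> A})
    (D : set A) (E : {linear A -> A}) : Prop := {
  afp_inj1 : injective j1 ;
  afp_inj2 : injective j2 ;
  afp_star1 : {morph j1 : a / star a} ;
  afp_star2 : {morph j2 : a / star a} ;
  afp_base : forall k, j1 (e1 k) = j2 (e2 k) ;
  afp_baseD : D = j1 @` generated_algebra (range e1) ;
  afp_generated :
    generated_algebra (range j1 `|` range j2) = [set: A] ;
  afp_space : valued_probability_space D E ;
  afp_E1 : forall a, E (j1 a) = j1 (E1 a) ;
  afp_E2 : forall a, E (j2 a) = j2 (E2 a) ;
  afp_free : free_pair_over D E (range j1) (range j2)
}.

(* Main.v *)
(* Put c_i = x_i x_i^* and let D0 be the elements of D of trace zero. Since     *)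
(* the D-valued cumulants of x_i vanish on words of odd length, so do its       *)
(* D-valued moments; this is all that R-diagonality contributes. A word in      *)
(* x_1 x_2 and its adjoint splits into runs, alternating words in x_i and       *)
(* x_i^* for one i, such that the last letter of a run and the first of the     *)
(* next are both starred or both unstarred. A run is c_i^k, x_i^* c_i^k x_i,    *)
(* c_i^k x_i or x_i^* c_i^k, and once made trace zero it is annihilated by E    *)
(* unless it is of the second form, when E sends it into D0. Its neighbours     *)
(* then merge around an element of D0 into a piece of the same nature, because  *)
(* c_i is free from D. By induction on the number of pieces, amalgamated        *)
(* freeness kills the trace of a product of centred runs. In A' the same holds  *)
(* directly by freeness. Uncentring the runs deletes runs of even length, so    *)
(* induction on the length of the word shows that its trace depends only on     *)
(* the traces of single runs, which agree on both sides.                        *)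
Require Import Defs.
From HB Require Import structures.
From mathcomp Require Import all_boot all_order all_algebra.
From mathcomp Require Import boolp classical_sets reals.
From mathcomp Require Import complex.
Set Implicit Arguments.
Unset Strict Implicit.
Unset Printing Implicit Defensive.
Import Order.TTheory GRing.Theory Num.Theory.
Local Open Scope classical_set_scope.
Local Open Scope ring_scope.

(** A trace on words with [linked] consecutive letters is determined by its values on single runs as
    soon as it vanishes on products of centred runs and the constants of odd runs are zero: this is
    [linked_moments], applied to both sides at once. In [A'] the vanishing is plain freeness. On the
    triangular side a run of trace zero may still have a nonzero expectation in [D], which blocks
    amalgamated freeness. By [expectation_odd_letters] and [expectation_piece] only runs from
    [star x] to [x] have this defect; their expectation [d] has trace zero, and [piece_merge] glues
    the neighbours of [d] into one piece. [expectation_chain] makes this an induction on the number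
    of pieces. *)

Section GeneratedAlgebra.
Variables (C : numClosedFieldType) (A : starAlgType C).
Implicit Types (B X : set A) (a b : A).

Lemma subalg_closedE B :
  GRing.subalg_closed (mem B) <->
  [/\ B 1, forall (c : C) a b, B a -> B b -> B (c *: a + b)
    & forall a b, B a -> B b -> B (a * b)].
Proof.
split=> -[B1 Blin BM]; split.
- by have := B1; rewrite in_setE.
- move=> c a b aB bB; have := Blin c a b; rewrite !in_setE; exact.
- move=> a b aB bB; have := BM a b; rewrite !in_setE; exact.
- by rewrite in_setE.
- by move=> c a b; rewrite !in_setE; exact: Blin.
- by move=> a b; rewrite !in_setE; exact: BM.
Qed.

Lemma subalg_closed0 B : GRing.subalg_closed (mem B) -> B 0.
Proof.
by case/subalg_closedE=> B1 Bl _; rewrite -(addNr (1 : A)) -scaleN1r; exact: Bl.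
Qed.

Lemma subalg_closedD B a b :
  GRing.subalg_closed (mem B) -> B a -> B b -> B (a + b).
Proof. by case/subalg_closedE=> _ Bl _ aB bB; rewrite -[a]scale1r; exact: Bl. Qed.

Lemma subalg_closedZ B (c : C) a :
  GRing.subalg_closed (mem B) -> B a -> B (c *: a).
Proof.
move=> HB aB; have B0 := subalg_closed0 HB; case/subalg_closedE: HB => _ Bl _.
by rewrite -[c *: a]addr0; exact: Bl.
Qed.

Lemma subalg_closed_scalar B (c : C) : GRing.subalg_closed (mem B) -> B c%:A.
Proof. by move=> HB; apply: subalg_closedZ => //; case/subalg_closedE: HB. Qed.

Lemma subalg_closedM B a b :
  GRing.subalg_closed (mem B) -> B a -> B b -> B (a * b).
Proof. by case/subalg_closedE=> _ _; exact. Qed.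

Lemma subalg_closed1 B : GRing.subalg_closed (mem B) -> B 1.
Proof. by case/subalg_closedE. Qed.

Lemma subalg_closed_prod (I : Type) (r : seq I) (F : I -> A) B :
  GRing.subalg_closed (mem B) -> (forall i, B (F i)) -> B (\prod_(i <- r) F i).
Proof.
move=> HB BF; elim: r => [|i r IH]; first by rewrite big_nil; exact: subalg_closed1.
by rewrite big_cons; exact: subalg_closedM.
Qed.

Lemma subalg_closed_sum (I : Type) (r : seq I) (F : I -> A) B :
  GRing.subalg_closed (mem B) -> (forall i, B (F i)) -> B (\sum_(i <- r) F i).
Proof.
move=> HB BF; elim: r => [|i r IH]; first by rewrite big_nil; exact: subalg_closed0.
by rewrite big_cons; exact: subalg_closedD.
Qed.

Lemma subalg_closed_generated X : GRing.subalg_closed (mem (generated_algebra X)).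
Proof.
apply/subalg_closedE; split=> [B [HB _]|c a b aG bG B BX|a b aG bG B BX].
- exact: subalg_closed1 HB.
- case/subalg_closedE: (BX.1) => _ Bl _.
  by apply: Bl; [apply: aG|apply: bG].
- by apply: subalg_closedM BX.1 _ _; [apply: aG|apply: bG].
Qed.

Lemma sub_generated X : X `<=` generated_algebra X.
Proof. exact: sub_smallest. Qed.

Lemma generated_sub X B :
  GRing.subalg_closed (mem B) -> X `<=` B -> generated_algebra X `<=` B.
Proof. by move=> HB XB; apply: smallest_sub. Qed.

End GeneratedAlgebra.

(** * Alternating words and freeness of two families *)

Section Alternating.
Variable T : Type.

Fixpoint alternating (Q : bool -> T -> Prop) (b : bool) (s : seq T) : Prop :=
  if s is z :: s' then Q b z /\ alternating Q (~~ b) s' else True.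

Lemma alternating_cat Q b u v :
  alternating Q b (u ++ v) <->
  alternating Q b u /\ alternating Q (b (+) odd (size u)) v.
Proof.
elim: u b => [|z u IH] b /=; first by rewrite addbF; tauto.
by rewrite IH addbN -addNb; tauto.
Qed.

Lemma alternating_nth Q b s x0 i :
  alternating Q b s -> (i < size s)%N -> Q (b (+) odd i) (nth x0 s i).
Proof.
elim: s b i => [|z s IH] b [|i] //= [Qz Qs]; first by rewrite addbF.
by rewrite ltnS => /(IH _ _ Qs); rewrite addbN -addNb.
Qed.

End Alternating.

Section FreeWords.
Variables (C : numClosedFieldType) (A : starAlgType C) (D : set A) (E : A -> A).

(** With only two families, distinct consecutive indices have to alternate, so freeness becomes a
    statement on lists, suited to induction. *)
Lemma free_pair_alternating (X Y : set A) b (s : seq A) :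
  free_pair_over D E X Y -> s != [::] ->
  alternating (fun b z =>
    generated_algebra ((if b then X else Y) `|` D) z /\ E z = 0) b s ->
  E (\prod_(z <- s) z) = 0.
Proof.
move=> XY; case: s => // z0 s _ alt.
rewrite (big_nth 1) big_mkord.
have nthP i := alternating_nth 1 (i := i) alt.
apply: (XY _ (fun j => b (+) odd j) (fun j => nth 1 (z0 :: s) j)) => /=.
- by move=> j; case: (nthP j).
- by move=> j; case: (nthP j).
by move=> j k -> /=; case: b {alt nthP}; case: (odd j).
Qed.

End FreeWords.

(** * Vanishing odd moments of an R-diagonal element *)

Section OddWords.
Variables (C : numClosedFieldType) (A : starAlgType C) (D : set A) (E : A -> A).
Variables (kappa : seq A -> A) (x : A).
Hypothesis D_subalg : GRing.subalg_closed (mem D).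
Hypothesis kappaP : cumulants D E kappa.
Hypothesis kappa_alternating : forall w : seq (A * bool), w != [::] ->
  (forall p, p \in w -> D p.1) -> ~ alternating_even (unzip2 w) ->
  kappa [seq p.1 * star_power x p.2 | p <- w] = 0.

(** Coefficients on both sides let a letter absorb the value of a removed neighbouring block. *)
Definition letter : set A :=
  [set z | exists d d' s, [/\ D d, D d' & z = d * star_power x s * d']].

Lemma letterMl d z : D d -> letter z -> letter (d * z).
Proof.
move=> Dd [d1 [d2 [s [D1 D2 ->]]]]; exists (d * d1), d2, s.
by split=> //; [exact: subalg_closedM|rewrite !mulrA].
Qed.

Lemma letterMr d z : D d -> letter z -> letter (z * d).
Proof.
move=> Dd [d1 [d2 [s [D1 D2 ->]]]]; exists d1, (d2 * d), s.
by split=> //; [exact: subalg_closedM|rewrite !mulrA].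
Qed.

Lemma letter_star_power s : letter (star_power x s).
Proof.
by exists 1, 1, s; rewrite mul1r mulr1; split=> //; exact: subalg_closed1.
Qed.

Lemma odd_alternating_even s : alternating_even s -> ~~ odd (size s).
Proof.
by case=> k [] ->; elim: k => //= k; rewrite negbK.
Qed.

Lemma cumulant_eq0 s : 0 \in s -> kappa s = 0.
Proof.
case/splitPr=> s1 s2; have := cumulant_linear kappaP s1 s2 1 0 0.
rewrite !scale1r addr0 => H.
by apply: (@addIr _ (kappa (s1 ++ 0 :: s2))); rewrite add0r.
Qed.

(** Right coefficients are passed on to the next letter, and the last one leaves the cumulant.
    R-diagonality then applies, since alternating even words have even length. *)
Lemma cumulant_odd (s : seq A) :
  {in s, forall z, letter z} -> odd (size s) -> kappa s = 0.
Proof.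
(* [w] holds the letters already freed of their right coefficient, [s1] the others. *)
suff gen (s1 : seq A) (w : seq (A * bool)) :
    {in s1, forall z, letter z} -> (forall p, p \in w -> D p.1) ->
    odd (size w + size s1) ->
    kappa ([seq p.1 * star_power x p.2 | p <- w] ++ s1) = 0.
  by move=> sL; exact: (gen s [::]).
elim/ltn_ind: {s1}(size s1) {-2}s1 w (leqnn (size s1)) => n IH [|z s1] w le_n sL wD.
  rewrite addn0 cats0 => ow; apply: kappa_alternating => //.
    by case: (w) ow.
  by move/odd_alternating_even; rewrite size_map ow.
have [d [d' [b [Dd Dd' ->]]]] := sL z (mem_head _ _).
case: s1 le_n sL => [|y s1] le_n sL ow.
  rewrite cats1 (cumulant_right kappaP) //.
  have -> : rcons [seq p.1 * star_power x p.2 | p <- w] (d * star_power x b)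
    = [seq p.1 * star_power x p.2 | p <- rcons w (d, b)] ++ [::].
    by rewrite map_rcons cats0.
  rewrite (IH 0%N) ?mul0r //.
  - by move=> p; rewrite mem_rcons inE => /orP[/eqP->|/wD].
  - by move: ow; rewrite size_rcons addn1 addn0.
rewrite (cumulant_balanced kappaP) // -cat_rcons.
have -> : rcons [seq p.1 * star_power x p.2 | p <- w] (d * star_power x b)
    = [seq p.1 * star_power x p.2 | p <- rcons w (d, b)] by rewrite map_rcons.
apply: (IH (size (d' * y :: s1))) => //.
- move=> u; rewrite inE => /orP[/eqP->|us].
    by apply: letterMl => //; apply: sL; rewrite !inE eqxx orbT.
  by apply: sL; rewrite !inE us !orbT.
- by move=> p; rewrite mem_rcons inE => /orP[/eqP->|/wD].
- by move: ow; rewrite size_rcons /= !addnS.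
Qed.

(** Invariant of the recursive evaluation: a zero letter is what remains next to a removed block
    whose cumulant vanished. *)
Definition degenerate n (w : seq ('I_n * A)) :=
  {in unzip2 w, forall z, letter z} /\ (odd (size w) \/ 0 \in unzip2 w).

Lemma cumulant_degenerate n (w : seq ('I_n * A)) :
  degenerate w -> kappa (unzip2 w) = 0.
Proof.
case=> wL [ow|]; last exact: cumulant_eq0.
by apply: cumulant_odd => //; rewrite size_map.
Qed.

(** If [u] is odd or contains 0, its cumulant is 0 and turns a neighbour into 0. Otherwise [u] is
    even, so its removal preserves the parity of the length, and any zero lies in [l] or [r] and
    survives. *)
Lemma degenerate_insert n (l u r : seq ('I_n * A)) :
  u != [::] -> (0 < size l + size r)%N -> degenerate (l ++ u ++ r) ->
  degenerate (insert_value l (kappa (unzip2 u)) r)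
  /\ size (insert_value l (kappa (unzip2 u)) r) = (size l + size r)%N.
Proof.
have unzip_cat (s t : seq ('I_n * A)) : unzip2 (s ++ t) = unzip2 s ++ unzip2 t.
  exact: map_cat.
have unzip_rcons (s : seq ('I_n * A)) y : unzip2 (rcons s y) = rcons (unzip2 s) y.2.
  exact: map_rcons.
move=> u0 lr; rewrite /degenerate !unzip_cat !size_cat => -[L odd0].
have uD : D (kappa (unzip2 u)).
  by apply: (cumulant_range kappaP); move: u0; case: (u).
have ku : odd (size u) \/ 0 \in unzip2 u -> kappa (unzip2 u) = 0.
  move=> H; apply: cumulant_degenerate; split=> // z zu; apply: L.
  by rewrite !mem_cat zu orbT.
move: (kappa _) uD ku => v vD ku.
case/lastP: l lr L odd0 => [|l [i a]] lr L odd0.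
  case: r lr L odd0 => [|[j b] r] // _ L odd0 /=.
  split=> //; split=> [z|].
    rewrite inE => /orP[/eqP->|zr].
      by apply: letterMl => //; apply: L; rewrite /= mem_cat inE eqxx orbT.
    by apply: L; rewrite /= mem_cat inE zr !orbT.
  case: (boolP (v == 0)) => [/eqP->|v0]; first by right; rewrite mul0r mem_head.
  have {}ku : ~ (odd (size u) \/ 0 \in unzip2 u) by move/ku/eqP; apply/negP.
  case: odd0; rewrite /= ?add0n => H.
    left; move: H; rewrite oddD /=; case: (odd (size u)) ku => // ku.
    by case: ku; left.
  right; move: H; rewrite mem_cat !inE => /or3P[H|/eqP <-|H].
  - by case: ku; right.
  - by rewrite mulr0 eqxx.
  - by rewrite H orbT.
have -> : insert_value (rcons l (i, a)) v r = rcons l (i, a * v) ++ r.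
  case: l {lr L odd0} => [|y l] //=.
  by rewrite last_rcons belast_rcons.
rewrite size_cat !size_rcons; split=> //.
rewrite !unzip_cat !unzip_rcons /=; split=> [z|].
  rewrite mem_cat mem_rcons inE -orbA => /or3P[/eqP->|zl|zr].
  - by apply: letterMr => //; apply: L; rewrite unzip_rcons mem_cat mem_rcons mem_head.
  - by apply: L; rewrite unzip_rcons mem_cat mem_rcons inE zl orbT.
  - by apply: L; rewrite !mem_cat zr !orbT.
case: (boolP (v == 0)) => [/eqP->|v0].
  by right; rewrite mulr0 mem_cat mem_rcons mem_head.
have {}ku : ~ (odd (size u) \/ 0 \in unzip2 u) by move/ku/eqP; apply/negP.
case: odd0; rewrite ?size_rcons => H.
  left; move: H; rewrite !oddD; case: (odd (size u)) ku => /= ku.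
    by case: ku; left.
  by rewrite addNb.
right; move: H; rewrite unzip_rcons !mem_cat !mem_rcons !inE -!orbA /=.
case/or4P=> [/eqP <-|H|H|H].
- by rewrite mul0r eqxx.
- by rewrite H orbT.
- by case: ku; right.
- by rewrite H !orbT.
Qed.

Lemma partition_cumulant_rec_degenerate n m (P : {set {set 'I_n}}) w :
  #|P| = m.+1 -> finset.set0 \notin P -> (\sum_(V in P) #|V|)%N = size w ->
  degenerate w -> partition_cumulant_rec kappa m P w = 0.
Proof.
elim: m P w => [|m IH] P w cP P0 szw wdeg /=; first exact: cumulant_degenerate.
(* Without an interval block the evaluation is 0 by definition. *)
case: pickP => // V /andP[VP]; rewrite infixE -cardE => /eqP takeV.
rewrite /remove_interval; set p := infix_index _ _ in takeV *.
set l := take p w; set u := take #|V| _; set r := drop _ w.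
have szV : (0 < #|V|)%N by rewrite card_gt0; apply: contraNneq P0 => <-.
have szu : size u = #|V|.
  by rewrite -[size u](size_map fst) map_take map_drop takeV -cardE.
have wE : w = l ++ u ++ r.
  by rewrite /l /u /r addnC -drop_drop !cat_take_drop.
have szlr : (\sum_(W in P :\ V) #|W|)%N = (size l + size r)%N.
  apply/eqP; rewrite -(eqn_add2l #|V|) -big_setD1 //= szw {1}wE !size_cat szu.
  by rewrite addnCA.
have cPV : #|P :\ V| = m.+1.
  by move: cP; rewrite (cardsD1 V) VP => -[].
have [|||ideg szi] := @degenerate_insert _ l u r _ _ _.
- by rewrite -size_eq0 szu -lt0n.
(* Another nonempty block is left, so the inserted value has a neighbour. *)
- rewrite -szlr; have /card_gt0P[W WP] : (0 < #|P :\ V|)%N by rewrite cPV.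
  rewrite (big_setD1 W WP) /= addn_gt0 card_gt0; apply/orP; left.
  by apply: contraNneq P0 => <-; move: WP; rewrite finset.in_setD1 => /andP[].
- by rewrite -wE.
apply: IH => //; last by rewrite szi.
by rewrite finset.in_setD1 negb_and P0 orbT.
Qed.

Lemma expectation_odd_letters (s : seq A) :
  {in s, forall z, letter z} -> odd (size s) -> E (\prod_(z <- s) z) = 0.
Proof.
case: s => // z s sL os.
rewrite (big_nth 0) big_mkord (moment_cumulant kappaP) big1 // => P.
rewrite finset.inE => /andP[partP _].
have /and3P[_ _ P0] := partP.
have szP := card_partition partP; rewrite finset.cardsT card_ord in szP.
have Pgt0 : (0 < #|P|)%N.
  by rewrite card_gt0; apply/eqP => P_0; move: szP; rewrite P_0 big_set0.
rewrite /partition_cumulant.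
apply: partition_cumulant_rec_degenerate => //; first by rewrite prednK.
  by rewrite size_map size_enum_ord.
set w := [seq _ | i <- _].
have wE : unzip2 w = z :: s.
  rewrite /unzip2 -map_comp (map_comp (nth 0 (z :: s)) val) val_enum_ord.
  by rewrite -/(mkseq _ _) mkseq_nth.
by split; [rewrite wE|left; rewrite -(size_map snd) -/(unzip2 w) wE].
Qed.

End OddWords.

(** The length is [l.+1], so that a run is never empty; its last letter is [s (+) odd l]. *)
Fixpoint stars (s : bool) (l : nat) : seq bool :=
  s :: if l is l'.+1 then stars (~~ s) l' else [::].

Lemma size_stars s l : size (stars s l) = l.+1.
Proof. by elim: l s => //= l IH s; rewrite IH. Qed.

(** * Words in one triangular element: parity and pieces *)

Section Component.
Variables (C : numClosedFieldType) (A : starAlgType C) (D : set A) (E : A -> A).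
Variables (phi : {scalar A}) (x : A).
Hypothesis D_subalg : GRing.subalg_closed (mem D).
Hypothesis E_linear : forall (c : C) a b, E (c *: a + b) = c *: E a + E b.
Hypothesis E_mulr : forall a d, D d -> E (a * d) = E a * d.
Hypothesis E_eq0 : forall a, (forall d, D d -> phi (a * d) = 0) -> E a = 0.
Hypothesis phiE : forall a, phi (E a) = phi a.
Hypothesis E_odd_letters : forall s : seq A,
  {in s, forall z, letter D x z} -> odd (size s) -> E (\prod_(z <- s) z) = 0.
Hypothesis phi1 : phi 1 = 1.
Hypothesis phi_tracial : forall a b, phi (a * b) = phi (b * a).
Hypothesis xx_free : free_pair phi [set x * star x] D.

Lemma linear_E0 : E 0 = 0.
Proof.
have := E_linear 1 0 0; rewrite !scale1r addr0 => H.
by apply: (@addIr _ (E 0)); rewrite add0r.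
Qed.

(* Parity of an element as a map between classes of right factors: this avoids *)
(* writing it as a sum of products of letters.                                 *)
Definition parity_test (b : bool) (y : A) :=
  forall (v : seq A) d, {in v, forall z, letter D x z} -> D d ->
    odd (size v) (+) b -> E (y * (\prod_(z <- v) z) * d) = 0.

Definition has_parity b z :=
  forall b' y, parity_test b' y -> parity_test (b' (+) b) (y * z).

Lemma has_parity_scalar (c : C) : has_parity false c%:A.
Proof.
move=> b y yP v d vL Dd; rewrite addbF => bv.
rewrite -scalerAr mulr1 -!scalerAl -[_ *: _]addr0 E_linear yP // scaler0.
by rewrite linear_E0 addr0.
Qed.

Lemma has_parityD b z1 z2 :
  has_parity b z1 -> has_parity b z2 -> has_parity b (z1 + z2).
Proof.
move=> H1 H2 b' y yP v d vL Dd bv.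
by rewrite mulrDr !mulrDl -[X in X + _]scale1r E_linear (H1 _ _ yP) // (H2 _ _ yP) //
   scaler0 addr0.
Qed.

Lemma has_parityM b1 b2 z1 z2 :
  has_parity b1 z1 -> has_parity b2 z2 -> has_parity (b1 (+) b2) (z1 * z2).
Proof.
by move=> H1 H2 b y yP; rewrite mulrA addbA; apply: H2; apply: H1.
Qed.

Lemma has_parity_base d : D d -> has_parity false d.
Proof.
move=> Dd b y yP [|z v] d' vL Dd'; rewrite addbF => bv.
  (* With no letter to its right, [d] joins the final coefficient; otherwise it joins the first
     letter. *)
  have := yP [::] (d * d') vL (subalg_closedM D_subalg Dd Dd') bv.
  by rewrite !big_nil !mulr1 mulrA.
have := yP (d * z :: v) d'; rewrite !big_cons !mulrA; apply=> // u.
rewrite inE => /orP[/eqP->|uv].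
  by apply: letterMl => //; apply: vL; exact: mem_head.
by apply: vL; rewrite inE uv orbT.
Qed.

Lemma has_parity_star_power s : has_parity true (star_power x s).
Proof.
move=> b y yP v d vL Dd; rewrite addbT addbN => bv.
have := yP (star_power x s :: v) d; rewrite big_cons !mulrA; apply=> //=.
  by move=> u; rewrite inE => /orP[/eqP->|/vL //]; exact: letter_star_power.
by rewrite addNb.
Qed.

Lemma parity_test1 : parity_test false 1.
Proof.
move=> v d vL Dd; rewrite addbF => ov.
by rewrite mul1r E_mulr // E_odd_letters // mul0r.
Qed.

Lemma expectation_odd z : has_parity true z -> E z = 0.
Proof.
move=> /(_ _ _ parity_test1 [::] 1); rewrite big_nil mul1r !mulr1; apply=> //.
exact: subalg_closed1.
Qed.

Definition polynomial : set A :=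
  generated_algebra ([set x * star x] `|` scalars (A := A)).

Lemma polynomial_subalg : GRing.subalg_closed (mem polynomial).
Proof. exact: subalg_closed_generated. Qed.

Lemma polynomial_xx : polynomial (x * star x).
Proof. by apply: sub_generated; left. Qed.

Lemma has_parity_polynomial p : polynomial p -> has_parity false p.
Proof.
apply: generated_sub.
  apply/subalg_closedE; split=> [|c a b aP bP|a b aP bP].
  - by rewrite -(scale1r (1 : A)); exact: has_parity_scalar.
  - apply: has_parityD => //; rewrite -mulr_algl -[false]addbF.
    by apply: has_parityM => //; exact: has_parity_scalar.
  - by rewrite -[false]addbF; exact: has_parityM.
move=> _ [->|[c _ <-]]; last exact: has_parity_scalar.
rewrite -[false]/(true (+) true).
apply: has_parityM; first exact: (has_parity_star_power false).
exact: (has_parity_star_power true).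
Qed.

Definition centered b z := (if b then polynomial z else D z) /\ phi z = 0.

Definition sub_phi z := z - (phi z)%:A.

Lemma phi_sub_phi z : phi (sub_phi z) = 0.
Proof. by rewrite raddfB /= linearZ /= phi1 mulr1 subrr. Qed.

Lemma centered_sub_phi b z :
  (if b then polynomial z else D z) -> centered b (sub_phi z).
Proof.
move=> zP; split; last exact: phi_sub_phi.
have HB : GRing.subalg_closed (mem (if b then polynomial else D)).
  by case: b {zP} => //; exact: polynomial_subalg.
have -> : (if b then polynomial (sub_phi z) else D (sub_phi z))
        = (if b then polynomial else D) (sub_phi z) by case: (b).
apply: subalg_closedD => //; first by case: (b) zP.
by rewrite -scaleNr; exact: subalg_closed_scalar.
Qed.

Lemma phi_alternating b (w : seq A) :
  alternating centered b w -> w != [::] -> phi (\prod_(z <- w) z) = 0.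
Proof.
move=> alt w0; have := free_pair_alternating (b := b) (s := w) xx_free w0.
rewrite /scalar_expectation => /(_ _)/eqP; rewrite scaler_eq0 oner_eq0 orbF.
move=> H; apply/eqP/H => {H w0}.
elim: w b alt => //= z w IH b [[zP z0] /IH wP]; split=> //; split.
  by case: b zP {wP} => // Dz; apply: sub_generated; left.
by rewrite z0 scale0r.
Qed.

(** The last factor need not be centred: it is a centred element plus a scalar, and either way a
    nonempty alternating centred word remains. *)
Lemma phi_alternatingM b (w : seq A) z :
  alternating centered b w -> w != [::] ->
  (if b (+) odd (size w) then polynomial z else D z) ->
  phi ((\prod_(y <- w) y) * z) = 0.
Proof.
move=> wA w0 zP.
rewrite -[z](subrK (phi z)%:A) -/(sub_phi z) mulrDr raddfD -scalerAr mulr1 /=.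
rewrite [phi (_ *: _)]linearZ /= (phi_alternating wA w0) mulr0 addr0.
have := @phi_alternating b (w ++ [:: sub_phi z]).
rewrite big_cat big_seq1; apply; last by case: (w).
by apply/alternating_cat; split=> //=; split=> //; exact: centered_sub_phi.
Qed.

Lemma has_parity_alternating b (w : seq A) :
  alternating centered b w -> has_parity false (\prod_(z <- w) z).
Proof.
elim: w b => [b _|z w IH b [[zP _] /IH wP]].
  by rewrite big_nil -(scale1r (1 : A)); exact: has_parity_scalar.
rewrite big_cons -[false]addbF; apply: has_parityM => //.
by case: b zP => [/has_parity_polynomial//|/has_parity_base].
Qed.

(* [piece s e] collects words in x, star x and D that start with star x iff s, *)
(* end with star x iff e, and in which D only enters through phi-centered      *)
(* elements separated by polynomials in x * star x. From star x to x, trace    *)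
(* zero is all that is needed.                                                 *)
Definition piece (s e : bool) (z : A) : Prop :=
  match s, e with
  | true, false => phi z = 0
  | false, true => exists w, [/\ alternating centered true w, odd (size w)
                               & z = \prod_(y <- w) y]
  | false, false => exists w p, [/\ alternating centered true w, ~~ odd (size w),
                      polynomial p & z = (\prod_(y <- w) y) * p * x]
  | true, true => exists w p, [/\ alternating centered false w, ~~ odd (size w),
                      polynomial p & z = star x * p * (\prod_(y <- w) y)]
  end.

(** A piece whose end letters agree has odd degree. For one from [x] to [star x], a right factor in
    [D] continues the alternation, so [phi (z * d)] vanishes for all [d] in [D]. *)
Lemma expectation_piece s e z : piece s e z -> ~~ (s && ~~ e) -> E z = 0.
Proof.
case: s e => [] [] //=
  => [[w [p [wA ow pP ->]]] _|[w [wA ow ->]] _|[w [p [wA ow pP ->]]] _].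
- apply: expectation_odd; rewrite -[true]/(true (+) false).
  apply: has_parityM (has_parity_alternating wA).
  rewrite -[true]/(true (+) false); apply: has_parityM.
    exact: (has_parity_star_power true).
  exact: has_parity_polynomial.
- have w0 : w != [::] by case: (w) ow.
  by apply: E_eq0 => d Dd; apply: phi_alternatingM wA w0 _; rewrite ow.
- apply: expectation_odd; rewrite -[true]/((false (+) false) (+) true).
  apply: has_parityM; last exact: (has_parity_star_power false).
  by apply: has_parityM; [exact: has_parity_alternating wA|exact: has_parity_polynomial].
Qed.

Lemma piece_merge s e u d v :
  D d -> phi d = 0 -> piece s true u -> piece false e v -> piece s e (u * d * v).
Proof.
move=> Dd phid; have dc : centered false d by [].
case: s e => [] [] /=.
- move=> [w [p [wA ow pP ->]]] [w' [wA' ow' ->]].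
  exists (w ++ d :: w'), p; split=> //.
  + by apply/alternating_cat; rewrite (negbTE ow).
  + by rewrite size_cat oddD /= (negbTE ow) ow'.
  + by rewrite big_cat big_cons /= !mulrA.
- move=> [w [p [wA ow pP ->]]] [w' [q [wA' ow' qP ->]]].
  set W := w ++ d :: w'.
  have WA : alternating centered false W.
    by apply/alternating_cat; rewrite (negbTE ow).
  have W0 : W != [::] by rewrite /W; case: (w).
  have -> : star x * p * \prod_(y <- w) y * d * (\prod_(y <- w') y * q * x)
          = star x * p * (\prod_(y <- W) y * (q * x)).
    by rewrite big_cat big_cons /= !mulrA.
  (* Cyclicity carries [star x * p] to the end, where [q * x * star x * p] is a polynomial following
     a word that ends in [D]. *)
  rewrite phi_tracial -!mulrA.
  have xxp : polynomial (x * (star x * p)).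
    by rewrite mulrA; exact: subalg_closedM polynomial_subalg polynomial_xx pP.
  have := subalg_closedM polynomial_subalg qP xxp.
  move=> rP; apply: phi_alternatingM WA W0 _.
  by rewrite size_cat oddD /= (negbTE ow) ow'.
- move=> [w [wA ow ->]] [w' [wA' ow' ->]].
  exists (w ++ d :: w'); split=> //.
  + by apply/alternating_cat; rewrite ow.
  + by rewrite size_cat oddD /= ow ow'.
  + by rewrite big_cat big_cons /= !mulrA.
- move=> [w [wA ow ->]] [w' [q [wA' ow' qP ->]]].
  exists (w ++ d :: w'), q; split=> //.
  + by apply/alternating_cat; rewrite ow.
  + by rewrite size_cat oddD /= ow (negbTE ow').
  + by rewrite big_cat big_cons /= !mulrA.
Qed.

Lemma has_parity_stars (r : seq bool) :
  has_parity (odd (size r)) (\prod_(s <- r) star_power x s).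
Proof.
elim: r => [|s r IH] /=.
  by rewrite big_nil -(scale1r (1 : A)); exact: has_parity_scalar.
by rewrite big_cons -addTb; apply: has_parityM => //; exact: has_parity_star_power.
Qed.

Lemma phi_stars_odd s l : ~~ odd l -> phi (\prod_(s <- stars s l) star_power x s) = 0.
Proof.
move=> ol; rewrite -phiE expectation_odd ?raddf0 //.
have := @has_parity_stars (stars s l).
by rewrite size_stars /= ol.
Qed.

Lemma prod_stars s l : exists2 p, polynomial p &
  \prod_(s <- stars s l) star_power x s
    = (if s then star x else 1) * p * (if s (+) odd l then 1 else x).
Proof.
elim: l s => [|l IH] s.
  exists 1; first exact: subalg_closed1 polynomial_subalg.
  by rewrite /= big_seq1 addbF; case: s; rewrite !(mulr1, mul1r).
have [p pP E_p] := IH (~~ s); rewrite /= big_cons E_p addbN -addNb.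
case: s {IH E_p} => /=; first by exists p => //; rewrite mul1r !mulrA.
exists (x * star x * p); last by rewrite mul1r !mulrA.
exact: subalg_closedM polynomial_subalg polynomial_xx pP.
Qed.

Lemma piece_stars s l :
  piece s (s (+) odd l) (sub_phi (\prod_(s <- stars s l) star_power x s)).
Proof.
case: (boolP (odd l)) => [ol|nol].
  have [p pP ->] := prod_stars s l.
  rewrite ol addbT; case: s => /=; first exact: phi_sub_phi.
  exists [:: sub_phi (1 * p * 1)]; split=> //; last by rewrite big_seq1.
  by split=> //; apply: centered_sub_phi; rewrite mul1r mulr1.
(* Even [l] means odd length: the trace is already zero. *)
rewrite /sub_phi phi_stars_odd // scale0r subr0.
have [p pP ->] := prod_stars s l.
rewrite (negbTE nol) addbF; case: s => /=; exists [::], p; split=> //.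
  by rewrite big_nil.
by rewrite big_nil.
Qed.

End Component.

(** * Products of pieces under amalgamated freeness *)

Section AlternatingPieces.
Variables (C : fieldType) (A : algType C) (D : set A) (E : {linear A -> A}).
Variables (f : A -> C) (G : bool -> A -> Prop).
Variable Z : bool -> bool -> bool -> A -> Prop.
Hypothesis E_D : forall a, D (E a).
Hypothesis E_id : forall d, D d -> E d = d.
Hypothesis E_mull : forall d a, D d -> E (d * a) = d * E a.
Hypothesis E_mulr : forall a d, D d -> E (a * d) = E a * d.
Hypothesis fD : forall a b, f (a + b) = f a + f b.
Hypothesis fE : forall a, f (E a) = f a.
Hypothesis G_free : forall b s, s != [::] ->
  alternating (fun b z => G b z /\ E z = 0) b s -> E (\prod_(z <- s) z) = 0.
Hypothesis ZG : forall i s e z, Z i s e z -> G i z.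
Hypothesis Z_eq0 : forall i s e z, Z i s e z -> ~~ (s && ~~ e) -> E z = 0.
Hypothesis Z_center : forall i z, Z i true false z ->
  f z = 0 /\ Z i true false (z - E z).
Hypothesis Z_merge : forall i s e u d v, D d -> f d = 0 ->
  Z i s true u -> Z i false e v -> Z i s e (u * d * v).

(** The boolean stored with a piece is its end type, and also the start type of the next piece. *)
Fixpoint chain (i s : bool) (zs : seq (A * bool)) (e : bool) : Prop :=
  if zs is q :: zs' then Z i s q.2 q.1 /\ chain (~~ i) q.2 zs' e else s = e.

Lemma chain_cat i s u v e :
  chain i s (u ++ v) e <->
  exists m, chain i s u m /\ chain (i (+) odd (size u)) m v e.
Proof.
elim: u i s => [|q u IH] i s /=.
  by rewrite addbF; split=> [H|[m [-> //]]]; exists s.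
rewrite IH addbN -addNb; split=> [[Zq [m [H1 H2]]]|[m [[Zq H1] H2]]].
  by exists m.
by split=> //; exists m.
Qed.

Lemma expectation_chain_centered i s zs e : zs != [::] ->
  chain i s zs e -> {in zs, forall q, E q.1 = 0} -> E (\prod_(q <- zs) q.1) = 0.
Proof.
move=> zs0 zsP E0; rewrite -(big_map fst xpredT id) /=.
apply: (G_free (b := i)); first by case: (zs) zs0.
elim: zs i s {zs0} zsP E0 => //= q zs IH i s [Zq zsP] E0.
split; first by split; [exact: ZG Zq|apply: E0; exact: mem_head].
by apply: IH zsP _ => q' q'zs; apply: E0; rewrite inE q'zs orbT.
Qed.

Lemma functional0 : f 0 = 0.
Proof. by apply: (@addIr _ (f 0)); rewrite -fD !add0r. Qed.

Lemma functional_eq0 a : E a = 0 -> f a = 0.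
Proof. by rewrite -fE => ->; exact: functional0. Qed.

(** The clause on [E] strengthens the induction: when an element of [D] at an end of the word is
    pulled out of [E], the rest must vanish under [E] and not only under [f]. *)
Lemma expectation_chain i s zs e : zs != [::] -> chain i s zs e ->
  f (\prod_(q <- zs) q.1) = 0 /\ (~~ (s && ~~ e) -> E (\prod_(q <- zs) q.1) = 0).
Proof.
move: {-1}(size zs) (leqnn (size zs)) => n; elim/ltn_ind: n zs i s e => n IHn zs i s e.
have {}IHn zs' i' s' e' : (size zs' < n)%N -> zs' != [::] -> chain i' s' zs' e' ->
    f (\prod_(q <- zs') q.1) = 0 /\
    (~~ (s' && ~~ e') -> E (\prod_(q <- zs') q.1) = 0).
  by move=> lt_n; exact: IHn lt_n _ _ _ _ (leqnn _).
(* [ps] is the prefix already annihilated piecewise by [E]; once it is the whole word, freeness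
   applies. *)
suff gen ps : (size (ps ++ zs) <= n)%N -> {in ps, forall q, E q.1 = 0} ->
    ps ++ zs != [::] -> chain i s (ps ++ zs) e ->
    f (\prod_(q <- ps ++ zs) q.1) = 0 /\
    (~~ (s && ~~ e) -> E (\prod_(q <- ps ++ zs) q.1) = 0).
  by move=> le_n; exact: (gen [::] le_n).
elim: zs ps => [|[z m] zs IH] ps le_n psE zs0 zsP.
  rewrite cats0 in zs0 zsP *.
  have E0 := expectation_chain_centered zs0 zsP psE.
  by split=> //; exact: functional_eq0.
have [k [psP /= [Zz zsP']]] := (chain_cat _ _ _ _ _).1 zsP.
have IHps y : Z (i (+) odd (size ps)) k m y -> E y = 0 ->
  f (\prod_(q <- ps ++ (y, m) :: zs) q.1) = 0 /\
  (~~ (s && ~~ e) -> E (\prod_(q <- ps ++ (y, m) :: zs) q.1) = 0).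
  move=> Zy Ey; rewrite -cat_rcons; apply: IH.
  - by move: le_n; rewrite !size_cat size_rcons addnS.
  - by move=> q; rewrite mem_rcons inE => /orP[/eqP->|/psE].
  - by case: (ps).
  - by rewrite cat_rcons; apply/chain_cat; exists k.
case: (eqVneq (E z) 0) => [/(IHps _ Zz) //|Ez0].
have /andP[kT /negbTE mF] : k && ~~ m.
  by apply: contra_neqT Ez0; exact: Z_eq0 Zz.
rewrite {}kT {}mF in psP Zz zsP' IHps.
have [fz Zz'] := Z_center Zz.
(* In [z = (z - E z) + E z] the first summand continues the inner induction; the second lies in [D]
   and has trace zero. *)
have [] := IHps _ Zz' _; first by rewrite linearB /= (E_id (E_D z)) subrr.
rewrite !big_cat !big_cons /=; set a := _ * ((z - _) * _) => fa Ea.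
have -> : \prod_(q <- ps) q.1 * (z * \prod_(q <- zs) q.1)
    = a + \prod_(q <- ps) q.1 * E z * \prod_(q <- zs) q.1.
  by rewrite -mulrA -mulrDr -mulrDl subrK.
suff [fb Eb] : f (\prod_(q <- ps) q.1 * E z * \prod_(q <- zs) q.1) = 0 /\
  (~~ (s && ~~ e) -> E (\prod_(q <- ps) q.1 * E z * \prod_(q <- zs) q.1) = 0).
  by split=> [|se]; [rewrite fD fa fb addr0|rewrite linearD /= Ea // Eb // addr0].
have fEz : f (E z) = 0 by rewrite fE.
have ED := E_D z.
move: (E z) ED fEz => d Dd fd {a fa Ea IHps Zz Zz' fz Ez0 IH zs0 zsP}.
rewrite size_cat /= in le_n.
case/lastP: ps psP zsP' le_n {psE} => [|ps [u ku]] psP zsP' le_n.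
  rewrite big_nil mul1r; case: zs zsP' le_n => [|q zs] zsP' le_n.
    (* The whole word is [d], from starred to unstarred, so only [f d = 0] is asked. *)
    by rewrite big_nil mulr1; split=> //; move: psP zsP' => /= -> <-.
  have [//|//|_ E0] := IHn _ _ _ _ _ _ zsP'.
  have {}E0 : E (d * \prod_(q <- q :: zs) q.1) = 0 by rewrite E_mull // E0 // mulr0.
  by split=> //; exact: functional_eq0.
have /chain_cat[k' [psP' /= [Zu ku1]]] : chain i s (ps ++ [:: (u, ku)]) true.
  by rewrite cats1.
subst ku.
case: zs zsP' le_n => [|[v kv] zs] zsP' le_n.
  rewrite big_nil mulr1.
  have [||_ E0] := IHn _ _ _ _ _ _ psP.
  - by apply: leq_trans le_n; rewrite addn1.
  - by case: (ps).
  have {}E0 : E (\prod_(q <- rcons ps (u, true)) q.1 * d) = 0.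
    by rewrite E_mulr // E0 ?mul0r // andbF.
  by split=> //; exact: functional_eq0.
have [Zv zsP] := zsP'.
(* Both neighbours of [d] have the same index; merging turns three pieces into one. *)
have := IHn (ps ++ (u * d * v, kv) :: zs) i s e.
rewrite -cats1 !big_cat big_seq1 !big_cons /= !mulrA; apply.
- apply: leq_trans le_n; rewrite size_cat size_rcons /= !addnS !addSn.
  exact: leqnSn.
- by case: (ps).
apply/chain_cat; exists k'; split=> //=; split.
  apply: Z_merge Zu _ => //.
  by move: Zv; rewrite size_rcons /= addbN negbK.
by move: zsP; rewrite size_rcons /= addbN negbK.
Qed.

End AlternatingPieces.

(* A letter (i, s) stands for x_1 or x_2 (i = true is x_1), starred iff s.     *)
(* Linked words contain the words in x_1 x_2 and its adjoint and are stable    *)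
(* under removal of a maximal run of even length.                              *)
Definition linked (p q : bool * bool) := (p.1 == q.1) == (p.2 != q.2).

Fixpoint runs (i s : bool) (ls : seq nat) : seq (bool * bool) :=
  if ls is l :: ls' then [seq (i, b) | b <- stars s l] ++ runs (~~ i) (s (+) odd l) ls'
  else [::].

Lemma runs_of_linked i s w : path linked (i, s) w ->
  exists2 ls, ls != [::] & (i, s) :: w = runs i s ls.
Proof.
elim: w i s => [|[j t] w IH] i s /=; first by exists [:: 0%N].
case/andP=> ij /IH[[//|l ls] _ ->].
move: ij; rewrite /linked /=; case: (eqVneq i j) => [<-|ij] /eqP.
  move=> st; exists (l.+1 :: ls) => //=.
  have -> : t = ~~ s by move: st; case: (s); case: (t).
  by rewrite addbN addNb.
move=> st; exists (0%N :: l :: ls) => //=.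
have -> : t = s by move: st; case: (s); case: (t).
have -> : j = ~~ i by move: ij; case: (i); case: (j).
by rewrite addbF.
Qed.

(** An even run begins and ends with opposite stars, so the letters around it share the other index
    and have opposite stars: they are linked again. *)
Lemma linked_remove_run u i s l ls : odd l ->
  sorted linked (u ++ runs i s (l :: ls)) ->
  sorted linked (u ++ runs (~~ i) (s (+) odd l) ls).
Proof.
move=> ol; case: u => [|p u]; first by rewrite /= => /cat_sorted2[].
case: l ol => // l ol; rewrite /= !cat_path /=.
case/and3P=> -> pis; rewrite cat_path => /andP[_] /=.
case: ls => //= l' ls.
rewrite -[odd l.+1]/(~~ odd l) in ol; rewrite ol addbT.
by case: l' => [|l'] /= /andP[_ ->]; rewrite andbT; move: pis; rewrite /linked /=;
  case: (last p u) => [[] []] /=; case: (i); case: (s).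
Qed.

(** * Uncentring runs, and the moments of linked words *)

Section CenteredRuns.
Variables (C : fieldType) (A : algType C) (ev : bool * bool -> A).
Variable c : bool -> bool -> nat -> C.

Fixpoint run_pieces (i s : bool) (ls : seq nat) : seq (A * bool) :=
  if ls is l :: ls' then
    (\prod_(b <- stars s l) ev (i, b) - (c i s l)%:A, s (+) odd l)
      :: run_pieces (~~ i) (s (+) odd l) ls'
  else [::].

Definition centered_runs i s ls := \prod_(q <- run_pieces i s ls) q.1.

Lemma centered_runs_cons u i s l ls :
  (\prod_(p <- u) ev p) * centered_runs i s (l :: ls) =
  (\prod_(p <- u ++ [seq (i, b) | b <- stars s l]) ev p)
     * centered_runs (~~ i) (s (+) odd l) ls
  - c i s l *: ((\prod_(p <- u) ev p) * centered_runs (~~ i) (s (+) odd l) ls).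
Proof.
rewrite /centered_runs /= big_cat big_map big_cons /= mulrBl mulrBr mulrA; congr (_ - _).
by rewrite -scalerAl mul1r scalerAr.
Qed.

End CenteredRuns.

Section LinkedMoments.
Variables (C : fieldType) (A A' : algType C) (f : A -> C) (f' : A' -> C).
Variables (ev : bool * bool -> A) (ev' : bool * bool -> A').
Variable c : bool -> bool -> nat -> C.
Hypothesis f_linear : forall k a b, f (k *: a + b) = k * f a + f b.
Hypothesis f'_linear : forall k a b, f' (k *: a + b) = k * f' a + f' b.
Hypothesis f1 : f 1 = f' 1.
Hypothesis c_odd : forall i s l, ~~ odd l -> c i s l = 0.
Hypothesis f_runs : forall i s ls, ls != [::] -> f (centered_runs ev c i s ls) = 0.
Hypothesis f'_runs : forall i s ls, ls != [::] ->
  f' (centered_runs ev' c i s ls) = 0.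

(** Interpolates between plain words ([ls] empty) and products of centred runs ([u] empty). *)
Let same u i s ls :=
  f ((\prod_(p <- u) ev p) * centered_runs ev c i s ls)
  = f' ((\prod_(p <- u) ev' p) * centered_runs ev' c i s ls).

Let same_cons u i s l ls :
  same (u ++ [seq (i, b) | b <- stars s l]) (~~ i) (s (+) odd l) ls ->
  (odd l -> same u (~~ i) (s (+) odd l) ls) -> same u i s (l :: ls).
Proof.
rewrite /same !centered_runs_cons => E1 E2.
rewrite ![_ - _]addrC -!scaleNr f_linear f'_linear E1.
(* For a run of odd length the constant is 0, so the word with that run deleted is never
   compared. *)
case: (boolP (odd l)) => [/[dup] ol /E2|/c_odd ->]; last by rewrite oppr0 !mul0r.
by rewrite ol => ->.
Qed.

Let same_cat u i s l ls :
  same u i s (l :: ls) ->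
  (odd l -> same u (~~ i) (s (+) odd l) ls) ->
  same (u ++ [seq (i, b) | b <- stars s l]) (~~ i) (s (+) odd l) ls.
Proof.
rewrite /same !centered_runs_cons => E1 E2.
move: E1; rewrite ![_ - _]addrC -!scaleNr f_linear f'_linear.
case: (boolP (odd l)) => [/[dup] ol /E2|/c_odd ->]; last by rewrite oppr0 !mul0r !add0r.
by rewrite ol => -> /addrI.
Qed.

Lemma linked_moments w : sorted linked w ->
  f (\prod_(p <- w) ev p) = f' (\prod_(p <- w) ev' p).
Proof.
move: {-1}(size w) (leqnn (size w)) => n; elim/ltn_ind: n w => n IHn w.
(* Partly centred words of length below [n] expand into plain linked words of length below [n]. *)
have shorter u i s ls : sorted linked (u ++ runs i s ls) ->
    (size (u ++ runs i s ls) < n)%N -> same u i s ls.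
  elim: ls u i s => [|l ls IH] u i s uP lt_n.
    move: uP lt_n; rewrite /same /centered_runs /= !big_nil cats0 !mulr1.
    by move=> uP lt_n; exact: IHn lt_n _ (leqnn _) uP.
  apply: same_cons.
    by apply: IH; rewrite -catA.
  move=> ol; apply: IH; first exact: linked_remove_run uP.
  by apply: leq_ltn_trans lt_n; rewrite !size_cat leq_add2l leq_addl.
(* Runs are written out from the left; each correction term is shorter. *)
have full u i s ls : sorted linked (u ++ runs i s ls) ->
    (size (u ++ runs i s ls) <= n)%N -> same u i s ls ->
    same (u ++ runs i s ls) i s [::].
  elim: ls u i s => [|l ls IH] u i s uP le_n us /=; first by rewrite cats0.
  rewrite catA; apply: IH (~~ i) (s (+) odd l) _ _ _; rewrite -?catA //.
  apply: same_cat us _ => ol; apply: shorter; first exact: linked_remove_run uP.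
  apply: leq_trans le_n; rewrite !size_cat ltn_add2l size_map size_stars.
  by rewrite addSn ltnS leq_addl.
case: w => [|[i s] w] le_n wP; first by rewrite !big_nil.
have [ls ls0 wE] := runs_of_linked wP.
have := full [::] i s ls; rewrite /= -wE => /(_ wP le_n).
rewrite /same /centered_runs /= !big_nil !mul1r !mulr1; apply.
by rewrite -!/(centered_runs _ _ _ _ _) f_runs ?f'_runs.
Qed.

End LinkedMoments.

(** * Pieces obtained from an upper triangular realization *)

Section Realization.
Variables (R : realType) (A B : starAlgType R[i]) (phi : {scalar A}) (x : A).
Variables (N : nat) (e : 'I_N -> A) (t : 'I_N -> R) (psi : {scalar B}) (y : B).
Hypothesis t_gt0 : forall k, 0 < t k.
Hypothesis utr : upper_triangular_realization phi x e t psi y.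

Local Notation D := (generated_algebra (range e)).
Local Notation E := (diagonal_expectation phi e).

Lemma diagonal_base_sum (c : 'I_N -> R[i]) : D (\sum_k c k *: e k).
Proof.
apply: (@subalg_closed_sum _ _ _ _ _ D) => [|k]; first exact: subalg_closed_generated.
apply: (@subalg_closedZ _ _ D); first exact: subalg_closed_generated.
by apply: sub_generated; exists k.
Qed.

Lemma diagonal_base d : D d -> exists c : 'I_N -> R[i], d = \sum_k c k *: e k.
Proof.
apply: (@generated_sub _ _ _ [set d | exists c : 'I_N -> R[i], d = \sum_k c k *: e k]) =>
  [|_ [k _ <-]]; last first.
  exists (fun l => (l == k)%:R); rewrite (bigD1 k) //= eqxx scale1r big1 ?addr0 // => l.
  by move=> /negbTE->; rewrite scale0r.
apply/subalg_closedE; split=> [|c a b [ca ->] [cb ->]|a b [ca ->] [cb ->]].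
- exists (fun=> 1); rewrite -(utr_sum utr); apply: eq_bigr => k _.
  by rewrite scale1r.
- exists (fun k => c * ca k + cb k); rewrite scaler_sumr -big_split /=.
  by apply: eq_bigr => k _; rewrite scalerDl scalerA.
- exists (fun k => ca k * cb k); rewrite mulr_suml; apply: eq_bigr => k _.
  rewrite mulr_sumr (bigD1 k) //= big1 ?addr0 => [|l lk].
    by rewrite -scalerAl -scalerAr (utr_proj utr k).2 scalerA.
  by rewrite -scalerAl -scalerAr (utr_orth utr) ?scaler0 // eq_sym.
Qed.

Lemma diagonal_baseM d : D d ->
  exists c : 'I_N -> R[i], forall k, d * e k = c k *: e k /\ e k * d = c k *: e k.
Proof.
case/diagonal_base=> c ->; exists c => k; split.
  rewrite mulr_suml (bigD1 k) //= big1 ?addr0 => [|l lk].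
    by rewrite -scalerAl (utr_proj utr k).2.
  by rewrite -scalerAl (utr_orth utr) ?scaler0.
rewrite mulr_sumr (bigD1 k) //= big1 ?addr0 => [|l lk].
  by rewrite -scalerAr (utr_proj utr k).2.
by rewrite -scalerAr (utr_orth utr) ?scaler0 // eq_sym.
Qed.

Lemma phi_proj_neq0 k : phi (e k) != 0.
Proof. by rewrite (utr_trace utr) fmorph_eq0 gt_eqF. Qed.

Lemma diagonal_expectation_linear (c : R[i]) a b : E (c *: a + b) = c *: E a + E b.
Proof.
rewrite /diagonal_expectation scaler_sumr -big_split; apply: eq_bigr => k _ /=.
by rewrite mulrDl linearD -scalerAl linearZ /= mulrDl scalerDl scalerA mulrA.
Qed.

Lemma diagonal_expectation_mulr a d : D d -> E (a * d) = E a * d.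
Proof.
case/diagonal_baseM=> c dE; rewrite /diagonal_expectation mulr_suml.
apply: eq_bigr => k _; rewrite -mulrA (dE k).1 -scalerAl (dE k).2 -scalerAr linearZ /=.
by rewrite scalerA -mulrA mulrC.
Qed.

Lemma diagonal_expectation_eq0 a : (forall d, D d -> phi (a * d) = 0) -> E a = 0.
Proof.
move=> a0; apply: big1 => k _; rewrite a0 ?mul0r ?scale0r //.
by apply: sub_generated; exists k.
Qed.

Lemma phi_diagonal_expectation a : phi (E a) = phi a.
Proof.
rewrite linear_sum /= -[in RHS](mulr1 a) -(utr_sum utr) mulr_sumr linear_sum /=.
by apply: eq_bigr => k _; rewrite linearZ /= divfK // phi_proj_neq0.
Qed.

Lemma realization_odd_letters (s : seq A) :
  {in s, forall z, letter D x z} -> odd (size s) -> E (\prod_(z <- s) z) = 0.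
Proof.
have [kappa [kappaP kappa0]] := utr_R_diagonal utr.
exact: expectation_odd_letters (subalg_closed_generated _) kappaP kappa0 s.
Qed.

Let space := utr_space utr.

Lemma realization_phi_odd s l :
  ~~ odd l -> phi (\prod_(b <- stars s l) star_power x b) = 0.
Proof.
apply: (phi_stars_odd (subalg_closed_generated _) diagonal_expectation_linear
  diagonal_expectation_mulr phi_diagonal_expectation realization_odd_letters).
Qed.

Section Embedding.
Variables (A0 : starAlgType R[i]) (j : {lrmorphism A -> A0}).
Variables (D0 : set A0) (E0 : {linear A0 -> A0}) (f : A0 -> R[i]).
Hypothesis D0E : D0 = j @` D.
Hypothesis E0j : forall a, E0 (j a) = j (E a).
Hypothesis fj : forall a, f (j a) = phi a.

Definition embedded_piece (s e' : bool) (z : A0) :=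
  exists2 a, piece D phi x s e' a & z = j a.

Lemma embedded_piece_eq0 s e' z : embedded_piece s e' z -> ~~ (s && ~~ e') -> E0 z = 0.
Proof.
case=> a aP -> se; rewrite E0j.
rewrite (expectation_piece (subalg_closed_generated _) diagonal_expectation_linear
  diagonal_expectation_mulr diagonal_expectation_eq0 realization_odd_letters
  (state_unital space) (utr_free utr) aP se) ?raddf0 //.
Qed.

(** Trace zero is the only condition on this type, and the expectation preserves the trace. *)
Lemma embedded_piece_center z :
  embedded_piece true false z -> f z = 0 /\ embedded_piece true false (z - E0 z).
Proof.
case=> a /= phia ->; rewrite fj; split=> //; exists (a - E a).
  by rewrite /piece raddfB /= phi_diagonal_expectation phia subrr.
by rewrite E0j raddfB.
Qed.

Lemma embedded_piece_merge s e' u d v : D0 d -> f d = 0 ->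
  embedded_piece s true u -> embedded_piece false e' v -> embedded_piece s e' (u * d * v).
Proof.
rewrite D0E => -[d1 Dd1 <-]; rewrite fj => phid [a aP ->] [b bP ->].
exists (a * d1 * b); last by rewrite !rmorphM.
exact: (piece_merge (subalg_closed_generated _) (state_unital space)
  (state_tracial space) (utr_free utr)).
Qed.

Lemma embedded_piece_stars s l : {morph j : a / star a} ->
  embedded_piece s (s (+) odd l)
    (\prod_(b <- stars s l) star_power (j x) b
       - (phi (\prod_(b <- stars s l) star_power x b))%:A).
Proof.
move=> j_star.
exists (sub_phi phi (\prod_(b <- stars s l) star_power x b)).
  exact: (piece_stars (subalg_closed_generated _) diagonal_expectation_linear
    diagonal_expectation_mulr phi_diagonal_expectation realization_odd_letters
    (state_unital space)).
rewrite /sub_phi raddfB /= [j _%:A]linearZ_LR rmorph1 rmorph_prod; congr (_ - _).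
by apply: eq_bigr => b _; case: b => //=; rewrite j_star.
Qed.

End Embedding.
End Realization.

(** * The product word and the comparison of both sides *)

Lemma chain_run_pieces (C : fieldType) (A : algType C) (ev : bool * bool -> A)
    (c : bool -> bool -> nat -> C) (Z : bool -> bool -> bool -> A -> Prop) i s ls :
  (forall i s l, Z i s (s (+) odd l)
     (\prod_(b <- stars s l) ev (i, b) - (c i s l)%:A)) ->
  exists e, chain Z i s (run_pieces ev c i s ls) e.
Proof.
move=> ZP; elim: ls i s => [|l ls IH] i s /=; first by exists s.
by have [e eP] := IH (~~ i) (s (+) odd l); exists e.
Qed.

Lemma alternating_run_pieces (C : fieldType) (A : algType C)
    (ev : bool * bool -> A)
    (c : bool -> bool -> nat -> C) (Q : bool -> A -> Prop) i s ls :
  (forall i s l, Q i (\prod_(b <- stars s l) ev (i, b) - (c i s l)%:A)) ->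
  alternating Q i (map fst (run_pieces ev c i s ls)).
Proof. by move=> QP; elim: ls i s => //= l ls IH i s; split. Qed.

Lemma run_pieces_neq0 (C : fieldType) (A : algType C) (ev : bool * bool -> A)
    (c : bool -> bool -> nat -> C) i s ls :
  ls != [::] -> run_pieces ev c i s ls != [::].
Proof. by case: ls. Qed.

Definition product_word (s : seq bool) : seq (bool * bool) :=
  flatten [seq [:: (~~ b, b); (b, b)] | b <- s].

Lemma linked_product_word s : sorted linked (product_word s).
Proof.
have blocks b r : path linked (b, b) (product_word r).
  elim: r b => //= a r IH b; rewrite IH /linked /=.
  by case: a; case: b.
by case: s => //= b s; rewrite blocks /linked /=; case: b.
Qed.

Lemma prod_product_word (C : numClosedFieldType) (A : starAlgType C)
    (x y : A) (ev : bool * bool -> A) s :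
  (forall p, ev p = star_power (if p.1 then x else y) p.2) ->
  \prod_(b <- s) star_power (x * y) b = \prod_(p <- product_word s) ev p.
Proof.
move=> evE; elim: s => [|b s IH]; first by rewrite !big_nil.
rewrite big_cons IH /product_word /= !big_cons !evE /= mulrA.
by case: b => //=; rewrite starM.
Qed.

Theorem theorem24 (R : realType)
  (A' : starAlgType R[i]) (phi' : {scalar A'}) (x1' x2' : A')
  (N : nat) (t : 'I_N -> R)
  (A1 : starAlgType R[i]) (phi1 : {scalar A1}) (x1 : A1) (e1 : 'I_N -> A1)
  (A2 : starAlgType R[i]) (phi2 : {scalar A2}) (x2 : A2) (e2 : 'I_N -> A2)
  (A : starAlgType R[i]) (j1 : {lrmorphism A1 -> A}) (j2 : {lrmorphism A2 -> A})
  (D : set A) (E : {linear A -> A}) (phi0 : A -> R[i]) :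
  scalar_probability_space phi' ->
  R_diagonal phi' x1' ->
  R_diagonal phi' x2' ->
  free_pair phi' [set x1'; star x1'] [set x2'; star x2'] ->
  (forall k, 0 < t k) ->
  \sum_k t k = 1 ->
  upper_triangular_realization phi1 x1 e1 t phi' x1' ->
  upper_triangular_realization phi2 x2 e2 t phi' x2' ->
  amalgamated_free_product e1 (diagonal_expectation phi1 e1)
    e2 (diagonal_expectation phi2 e2) j1 j2 D E ->
  (forall (c : R[i]) (d d' : A), D d -> D d' ->
     phi0 (c *: d + d') = c * phi0 d + phi0 d') ->
  (forall k, phi0 (j1 (e1 k)) = (t k)%:C%C) ->
  identically_distributed (fun a => phi0 (E a)) phi' (j1 x1 * j2 x2) (x1' * x2').
Proof.
move=> space' _ _ free' t_gt0 t_sum utr1 utr2 afp phi0_lin phi0_e.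
have [_ _ j1_star j2_star j1e DE _ [Dsub _ ED E1 Ebim] Ej1 Ej2 free] := afp.
have phi0Z c d : D d -> phi0 (c *: d) = c * phi0 d.
  have D0 : D 0 := subalg_closed0 Dsub.
  have phi00 : phi0 0 = 0.
    have := phi0_lin 1 0 0 D0 D0; rewrite scale1r addr0 mul1r => H.
    by apply: (@addIr _ (phi0 0)); rewrite add0r.
  by move=> Dd; have := phi0_lin c d 0 Dd D0; rewrite phi00 !addr0.
(* [phi0] is linear on [D] only, so each partial sum has to be shown to lie in [D]. *)
have phi0_sum (c : 'I_N -> R[i]) :
    phi0 (\sum_k c k *: j1 (e1 k)) = \sum_k c k * (t k)%:C%C.
  have De k : D (c k *: j1 (e1 k)).
    apply: subalg_closedZ => //; rewrite DE; exists (e1 k) => //.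
    by apply: sub_generated; exists k.
  elim: (index_enum _) => [|k r IH].
    by rewrite !big_nil -(scale0r (0 : A)) phi0Z ?mul0r //; exact: subalg_closed0 Dsub.
  rewrite !big_cons -[_ *: _]scale1r phi0_lin //; last exact: subalg_closed_sum.
  rewrite IH mul1r phi0Z ?phi0_e // DE; exists (e1 k) => //.
  by apply: sub_generated; exists k.
have phi0j1 d : generated_algebra (range e1) d -> phi0 (j1 d) = phi1 d.
  case/(diagonal_base utr1) => c ->; rewrite linear_sum /= [RHS]linear_sum /=.
  under eq_bigr do rewrite linearZ_LR.
  rewrite phi0_sum; apply: eq_bigr => k _.
  by rewrite linearZ /= (utr_trace utr1).
have phi0j2 d : generated_algebra (range e2) d -> phi0 (j2 d) = phi2 d.
  case/(diagonal_base utr2) => c ->; rewrite linear_sum /= [RHS]linear_sum /=.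
  under eq_bigr do rewrite linearZ_LR /= -j1e.
  rewrite phi0_sum; apply: eq_bigr => k _.
  by rewrite linearZ /= (utr_trace utr2).
(* Merging pieces pulls [d] back into either algebra, hence the description of [D] through [j2]. *)
have DE2 : D = j2 @` generated_algebra (range e2).
  rewrite DE; apply/seteqP; split=> _ [d Dd <-].
    have [c ->] := diagonal_base utr1 Dd.
    exists (\sum_k c k *: e2 k); first exact: diagonal_base_sum.
    by rewrite !linear_sum /=; apply: eq_bigr => k _; rewrite !linearZ_LR /= j1e.
  have [c ->] := diagonal_base utr2 Dd.
  exists (\sum_k c k *: e1 k); first exact: diagonal_base_sum.
  by rewrite !linear_sum /=; apply: eq_bigr => k _; rewrite !linearZ_LR /= j1e.
pose f a := phi0 (E a).
have fj1 a : f (j1 a) = phi1 a.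
  rewrite /f Ej1 phi0j1 ?(phi_diagonal_expectation t_gt0 utr1) //.
  exact: diagonal_base_sum.
have fj2 a : f (j2 a) = phi2 a.
  rewrite /f Ej2 phi0j2 ?(phi_diagonal_expectation t_gt0 utr2) //.
  exact: diagonal_base_sum.
have f_lin c a b : f (c *: a + b) = c * f a + f b.
  by rewrite /f linearP phi0_lin.
have E_D d : D d -> E d = d.
  move=> Dd; have := Ebim d 1 1 Dd (subalg_closed1 Dsub).
  by rewrite E1 !mulr1.
pose x i := if i then j1 x1 else j2 x2.
pose x' i := if i then x1' else x2'.
pose ev p := star_power (x p.1) p.2.
pose ev' p := star_power (x' p.1) p.2.
(* By [utr_dist] these constants are also the traces of the runs in [A']. *)
pose c (i s : bool) l := if i then phi1 (\prod_(b <- stars s l) star_power x1 b)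
                 else phi2 (\prod_(b <- stars s l) star_power x2 b).
pose Z (i s e : bool) z := if i
  then embedded_piece phi1 x1 e1 j1 s e z else embedded_piece phi2 x2 e2 j2 s e z.
move=> s.
rewrite (prod_product_word (ev := ev)) // (prod_product_word (ev := ev')) //.
apply: (linked_moments (f := f) (f' := phi') (c := c)) (linked_product_word s).
- exact: f_lin.
- by move=> k a b; rewrite linearP.
- by rewrite (state_unital space') -(rmorph1 j1) fj1 (state_unital (utr_space utr1)).
- move=> i {}s l ol; rewrite /c; case: i.
    exact: (realization_phi_odd t_gt0 utr1).
  exact: (realization_phi_odd t_gt0 utr2).
- move=> i {}s ls ls0.
  have [|e chainP] := @chain_run_pieces _ _ ev c Z i s ls.
    move=> {ls ls0 s i} [] s l.
      exact: (embedded_piece_stars t_gt0 utr1).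
    exact: (embedded_piece_stars t_gt0 utr2).
  pose G (b : bool) := generated_algebra ((if b then range j1 else range j2) `|` D).
  apply: (expectation_chain (f := f) (G := G) ED E_D _ _ _ _ _ _ _ _ _ _ chainP).1.
  + by move=> d a Dd; have := Ebim d 1 a Dd (subalg_closed1 Dsub); rewrite !mulr1.
  + by move=> a d Dd; have := Ebim 1 d a (subalg_closed1 Dsub) Dd; rewrite !mul1r.
  + by move=> a b; rewrite -[a]scale1r f_lin mul1r scale1r.
  + by move=> a; rewrite /f E_D.
  + by move=> b r r0; exact: free_pair_alternating free r0.
  + move=> b s0 e' z; rewrite /Z /G; case: b => -[a _ ->];
      by apply: sub_generated; left; exists a.
  + move=> b s0 e' z; rewrite /Z; case: b.
      exact: (embedded_piece_eq0 utr1 Ej1).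
    exact: (embedded_piece_eq0 utr2 Ej2).
  + move=> b z; rewrite /Z; case: b.
      exact: (embedded_piece_center t_gt0 utr1 Ej1 fj1).
    exact: (embedded_piece_center t_gt0 utr2 Ej2 fj2).
  + move=> b s0 e' u d v; rewrite /Z; case: b.
      exact: (embedded_piece_merge utr1 DE fj1).
    exact: (embedded_piece_merge utr2 DE2 fj2).
  + exact: run_pieces_neq0.
- move=> i {}s ls ls0.
  have phi'1 := state_unital space'.
  have gsub X := @subalg_closed_generated _ A' X.
  (* In [A'] the centred runs alternate between two free algebras. *)
  have := free_pair_alternating (b := i) free'
    (_ : map fst (run_pieces ev' c i s ls) != [::]).
  rewrite -size_eq0 size_map size_eq0 run_pieces_neq0 // => /(_ isT).
  rewrite big_map /scalar_expectation => prod0.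
  apply/eqP; move/(_ _)/eqP: prod0; rewrite scaler_eq0 oner_eq0 orbF; apply.
  apply: alternating_run_pieces => {ls ls0 s} b s l; split.
    apply: (subalg_closedD (gsub _)).
      apply: (subalg_closed_prod _ (gsub _)) => b'; apply: sub_generated; left.
      by rewrite /ev' /x' /=; case: (b); case: (b'); [right|left|right|left].
    by rewrite -scaleNr; exact: subalg_closed_scalar (gsub _).
  rewrite linearB [phi' _%:A]linearZ /= phi'1 mulr1 /c /ev' /x'; case: b => /=.
    by rewrite (utr_dist utr1) subrr scale0r.
  by rewrite (utr_dist utr2) subrr scale0r.
Qed.
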